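(* Let $p$ be a nonconstant real polynomial with $Z_{\mathbb{C}}(p)=2m$. Suppose that there exists $\sigma\in\mathbb{R}$ such that, with $p_\sigma(z)=p'(z)+\sigma p(z)$, one has $Q[p_\sigma](x)<0$ for all $x\in\mathbb{R}$ at which $Q[p_\sigma]$ is defined. Then $$Z_{\mathbb{R}}(Q[p])=2m-2m_\sigma,$$ where $2m_\sigma=Z_{\mathbb{C}}(p_\sigma)$. Moreover, every real zero of $Q[p]$ that is not a zero of $p_\sigma$ of multiplicity greater than $2$ is a simple zero of $Q[p]$.
   Context: For a polynomial $f$ that is not identically zero, $Q[f]$ denotes the rational function $$Q[f](z)=\frac{d}{dz}\left(\frac{f'(z)}{f(z)}\right)=\frac{f(z)f''(z)-(f'(z))^2}{(f(z))^2}.$$ For a polynomial or rational function $f$ that is not identically zero, $Z_{\mathbb{R}}(f)$ and $Z_{\mathbb{C}}(f)$ denote, respectively, the number of real zeroes and the number of non-real zeroes of $f$, counted with multiplicities (zeroes of a rational function being those of its reduced form). A real polynomial is a polynomial with real coefficients. *)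

(* Defs.v *)
From HB Require Import structures.
From mathcomp Require Import all_boot all_order all_algebra.
From mathcomp Require Import complex reals.

Set Implicit Arguments.
Unset Strict Implicit.
Unset Printing Implicit Defensive.

Import Order.TTheory GRing.Theory Num.Theory.
Local Open Scope ring_scope.

(* A rational function is an element of {fraction {poly K}}.  The
   representative [repr f] chosen by the quotient need not be in lowest
   terms, hence the division by the gcd; numerator and denominator are
   determined up to a common nonzero constant factor. *)
Definition ratf_num (K : fieldType) (f : {fraction {poly K}}) : {poly K} :=
  \n_(repr f) %/ gcdp \n_(repr f) \d_(repr f).

Definition ratf_den (K : fieldType) (f : {fraction {poly K}}) : {poly K} :=
  \d_(repr f) %/ gcdp \n_(repr f) \d_(repr f).

Definition ratf_defined_at (K : fieldType) (f : {fraction {poly K}}) (x : K) :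
    Prop :=
  (ratf_den f).[x] != 0.

(* Meaningful only if [ratf_defined_at f x]. *)
Definition ratf_eval (K : fieldType) (f : {fraction {poly K}}) (x : K) : K :=
  (ratf_num f).[x] / (ratf_den f).[x].

(* Q[f] = (f' / f)', expanded by the quotient rule. *)
Definition Q (K : fieldType) (f : {poly K}) : {fraction {poly K}} :=
  tofrac (f * f^`(2) - f^`() ^+ 2) / tofrac (f ^+ 2).

(* For f != 0, each root occurs as many times as its multiplicity. *)
Definition croots (R : realType) (f : {poly R}) : seq R[i] :=
  sval (closed_field_poly_normal (map_poly (real_complex R) f)).

Definition ZR (R : realType) (f : {poly R}) : nat :=
  count (fun z : R[i] => complex.Im z == 0) (croots f).

Definition ZC (R : realType) (f : {poly R}) : nat :=
  count (fun z : R[i] => complex.Im z != 0) (croots f).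

Definition ratf_ZR (R : realType) (f : {fraction {poly R}}) : nat :=
  ZR (ratf_num f).

(* Main.v *)
Require Import Defs.
From HB Require Import structures.
From mathcomp Require Import all_boot all_order all_algebra.
From mathcomp Require Import complex reals polyorder polyrcf qe_rcf_th zify ring.

Set Implicit Arguments.
Unset Strict Implicit.
Unset Printing Implicit Defensive.

Import Order.TTheory GRing.Theory Num.Theory.
Local Open Scope ring_scope.

(** Put [q = p' + sigma p] and let [N = p p'' - p'^2] be the numerator of [Q[p]].
    Since also [N = p q' - q p'], the rational function
    [H = N / (p q) = q'/q - p'/p] is the logarithmic derivative of [F = q/p],
    while [Q[p] = F'].  The proof counts the sign changes of [H] along the real
    line.

    - At a root of [p] ([multiplicities_at_root]), [H] has a simple pole of
      residue [-1], and [Q[p]] has a double pole.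
    - At a root of [q] of multiplicity [k] which is not a root of [p]
      ([multiplicities_at_pencil_root]), [H] has a simple pole of residue
      [k > 0], and [Q[p]] has a zero of multiplicity [k - 1].
    - At every other real zero of [Q[p]] ([multiplicities_at_critical_point]),
      [H' = Q[q] - Q[p] = Q[q] < 0], so that the zero is simple and [H] changes
      sign from [+] to [-] there.

    The last item is the only place where the negativity of [Q[q]] enters.  Let
    [r], [d] and [E] be the numbers of real points of these three kinds.  The
    Cauchy index of [H] is [d - r], that of [1/H] is [- E], and by the inversion
    formula ([cindexR_inv]) their sum is the variation of the sign of [H]
    between the two infinities, which is [0] if [sigma != 0] and [-1] if
    [sigma = 0] ([crossR_logder_num]).  Adding up the multiplicities of the real
    roots gives
    [ZR (Q[p]) = ZR q - ZR p + r - d + E],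
    and the count follows from [ZR f + ZC f = deg f], where
    [deg q = deg p - 1] exactly when [sigma = 0]. *)

(** * Real and non-real roots counted with multiplicity *)

(** The multiplicities [mup] and [\mu] are defined separately for fields and for
    integral domains; they agree on nonzero polynomials. *)
Lemma mup_mu (K : fieldType) (x : K) (f : {poly K}) :
  f != 0 -> mup x f = \mu_x f.
Proof.
move=> f0; apply/eqP; rewrite eqn_leq -root_le_mu // -mup_geq // leqnn /=.
by rewrite mup_geq // root_le_mu.
Qed.

Lemma mup_map (F L : fieldType) (h : {rmorphism F -> L}) (x : F) (f : {poly F}) :
  f != 0 -> mup (h x) (map_poly h f) = mup x f.
Proof.
move=> f0; have hf0 : map_poly h f != 0 by rewrite map_poly_eq0.
have E n : (n <= mup (h x) (map_poly h f))%N = (n <= mup x f)%N.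
  rewrite !mup_geq // -[RHS](dvdp_map h) rmorphXn rmorphB /=.
  by rewrite map_polyX map_polyC.
by apply/eqP; rewrite eqn_leq -E leqnn E leqnn.
Qed.

Lemma crootsE (R : realType) (f : {poly R}) :
  map_poly (real_complex R) f =
  real_complex R (lead_coef f) *: \prod_(z <- croots f) ('X - z%:P).
Proof.
rewrite /croots; case: closed_field_poly_normal => s /= {1}->.
by rewrite lead_coef_map.
Qed.

Lemma ZR_ZC (R : realType) (f : {poly R}) :
  f != 0 -> (ZR f + ZC f)%N = (size f).-1.
Proof.
move=> f0; rewrite /ZR /ZC count_predC.
have := crootsE f; move/(congr1 (fun q : {poly _} => size q)).
rewrite size_map_poly size_scale ?size_prod_XsubC; first by move=> ->.
by rewrite fmorph_eq0 lead_coef_eq0.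
Qed.

Lemma count_croots_real (R : realType) (f : {poly R}) (x : R) :
  f != 0 -> count_mem (x%:C)%C (croots f) = \mu_x f.
Proof.
move=> f0; have lc0 : real_complex R (lead_coef f) != 0.
  by rewrite fmorph_eq0 lead_coef_eq0.
rewrite -mup_mu // -(mup_map (real_complex R)) // crootsE -mul_polyC.
rewrite mupMr ?mu_prod_XsubC //.
by rewrite rootC.
Qed.

Lemma size_sum_count (T : eqType) (s t : seq T) :
  uniq s -> {subset t <= s} -> size t = (\sum_(x <- s) count_mem x t)%N.
Proof.
move=> us; elim: t => [|y t IH] sub; first by rewrite big1_seq.
rewrite /= big_split /= -IH; last by move=> z zt; apply: sub; rewrite inE zt orbT.
rewrite -add1n; congr addn; rewrite -big_mkcond sum1_count.
rewrite (eq_count (a2 := pred1 y)) ?count_uniq_mem ?sub ?mem_head //.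
Qed.

Lemma ZR_sum_mu (R : realType) (f : {poly R}) (s : seq R) :
  f != 0 -> uniq s -> (forall x, root f x -> x \in s) ->
  ZR f = (\sum_(x <- s) \mu_x f)%N.
Proof.
move=> f0 us sub.
pose t := [seq complex.Re z | z <- croots f & complex.Im z == 0].
have ct x : count_mem x t = \mu_x f.
  rewrite -count_croots_real // count_map count_filter; apply: eq_count => -[a b] /=.
  by rewrite eq_complex.
have -> : ZR f = size t by rewrite size_map size_filter.
rewrite (size_sum_count us); first by apply: eq_bigr.
move=> x xt; apply: sub; rewrite -mu_gt0 // -ct -has_count.
by apply/hasP; exists x => //=.
Qed.

(** Complex conjugation permutes the roots of a real polynomial, so the upper
    and the lower half-planes contain equally many of them. *)
Lemma ZC_even (R : realType) (f : {poly R}) :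
  f != 0 -> exists k, ZC f = (2 * k)%N.
Proof.
move=> f0; exists (count (fun z => 0 < complex.Im z) (croots f)).
have lc0 : real_complex R (lead_coef f) != 0.
  by rewrite fmorph_eq0 lead_coef_eq0.
have pe : perm_eq (croots f) (map conjc (croots f)).
  apply: prod_XsubC_eq; apply: (scalerI lc0); rewrite -crootsE.
  have <- : map_poly conjc (map_poly (real_complex R) f) = map_poly (real_complex R) f.
    by apply/polyP => i; rewrite !coef_map /= oppr0.
  rewrite [X in map_poly conjc X]crootsE map_polyZ /= rmorph_prod big_map.
  rewrite oppr0; congr (_ *: _); apply: eq_bigr => z _.
  by rewrite rmorphB /= map_polyX map_polyC.
have E : count (fun z => complex.Im z < 0) (croots f) =
         count (fun z => 0 < complex.Im z) (croots f).
  move/permP: pe => ->; rewrite count_map; apply: eq_count => -[a b] /=.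
  by rewrite oppr_lt0.
rewrite mulSn mul1n -{1}E /ZC.
elim: (croots f) => //= z s ->.
by case: (ltrgt0P (complex.Im z)) => _ /=; lia.
Qed.

(** * Cauchy indices on the whole line *)

(** Both indices count signed sign changes of [p * q]: the first at the poles of
    [q / p], the second at its zeros. *)
Lemma cindexR_inv (R : rcfType) (p q : {poly R}) : p != 0 -> q != 0 ->
  cindexR q p + cindexR p q = crossR (p * q).
Proof.
move=> p0 q0; have pq0 : p * q != 0 by rewrite mulf_neq0.
pose b := cauchy_bound (p * q).
have [lecb gecb] := (le_cauchy_bound pq0, ge_cauchy_bound pq0).
rewrite -!(@cindexRP _ _ _ (- b) b); do ?
  by [move=> x Hx /=; have: ~~ root (p * q) x by [apply: lecb|apply: gecb];
      rewrite rootM => /norP []].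
rewrite -(@crossRP _ _ (- b) b) //.
apply: cindex_inv; first by rewrite gt0_cp // cauchy_bound_gt0.
- by apply: lecb; rewrite boundr_in_itv.
- by apply: gecb; rewrite boundl_in_itv.
Qed.

(** A point that is not a root of [p] contributes no jump, so the index may be
    summed over any finite set that contains the roots. *)
Lemma cindexR_sum (R : rcfType) (p q : {poly R}) (s : seq R) :
  p != 0 -> uniq s -> (forall x, root p x -> x \in s) ->
  cindexR q p = \sum_(x <- s) jump q p x.
Proof.
move=> p0 us sub; rewrite [RHS](bigID (root p)) /= [X in _ + X]big1 ?addr0.
  rewrite /cindexR -big_filter; apply: perm_big; apply: uniq_perm.
  - exact: uniq_roots.
  - exact: filter_uniq.
  move=> x; rewrite mem_filter -roots_on_rootsR //=.
  by case rx: (root p x) => //=; rewrite sub.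
by move=> x; exact: noroot_jump.
Qed.

(** * Reduced forms of rational functions *)

Lemma tofrac_repr (K : idomainType) (f : {fraction K}) :
  tofrac \d_(repr f) * f = tofrac \n_(repr f).
Proof.
rewrite -{2}[f]reprK; move: (repr f) => y {f}.
unlock FracField.tofrac.
rewrite -[LHS]FracField.pi_mul; apply/eqmodP.
rewrite /= FracField.equivfE /FracField.mulf /=.
rewrite !numden_Ratio ?mulf_neq0 ?oner_neq0 ?denom_ratioP //.
by rewrite mulr1 mul1r.
Qed.

Lemma ratf_cross (K : fieldType) (N D : {poly K}) : D != 0 ->
  ratf_num (tofrac N / tofrac D) * D = ratf_den (tofrac N / tofrac D) * N.
Proof.
move=> D0; set f := _ / _; rewrite /ratf_num /ratf_den.
set g := gcdp _ _.
have d0 : \d_(repr f) != 0 by apply: denom_ratioP.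
have g0 : g != 0 by rewrite gcdp_eq0 (negPf d0) andbF.
apply: (mulIf g0); rewrite mulrAC divpK ?dvdp_gcdl // [RHS]mulrAC divpK ?dvdp_gcdr //.
apply/eqP; rewrite -tofrac_eq !rmorphM /= -tofrac_repr -mulrA.
by rewrite divfK // tofrac_eq0.
Qed.

Lemma ratf_coprime (K : fieldType) (f : {fraction {poly K}}) :
  coprimep (ratf_num f) (ratf_den f).
Proof.
rewrite /ratf_num /ratf_den; apply: coprimep_div_gcd.
by rewrite (denom_ratioP (repr f)) orbT.
Qed.

Lemma ratf_defined (K : fieldType) (N D : {poly K}) (x : K) : D.[x] != 0 ->
  ratf_defined_at (tofrac N / tofrac D) x.
Proof.
move=> Dx; have D0 : D != 0 by apply: contraNneq Dx => ->; rewrite horner0.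
set f := _ / _; apply/negP => /eqP dx.
have /(congr1 (horner^~ x)) := ratf_cross N D0; rewrite -/f !hornerM dx mul0r.
move/eqP; rewrite mulf_eq0 (negPf Dx) orbF => nx.
by have := coprimep_root (ratf_coprime f) nx; rewrite dx eqxx.
Qed.

Lemma ratf_evalE (K : fieldType) (N D : {poly K}) (x : K) : D.[x] != 0 ->
  ratf_eval (tofrac N / tofrac D) x = N.[x] / D.[x].
Proof.
move=> Dx; have D0 : D != 0 by apply: contraNneq Dx => ->; rewrite horner0.
have := ratf_defined N Dx; rewrite /ratf_defined_at /ratf_eval => dx.
have /(congr1 (horner^~ x)) := ratf_cross N D0; rewrite !hornerM => E.
by apply/eqP; rewrite eqr_div // E mulrC.
Qed.

Lemma mup_ratf_num (K : fieldType) (N D : {poly K}) (x : K) : N != 0 -> D != 0 ->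
  mup x (ratf_num (tofrac N / tofrac D)) = (\mu_x N - \mu_x D)%N.
Proof.
move=> N0 D0; set f := _ / _.
have E := ratf_cross N D0; rewrite -/f in E.
have cop := ratf_coprime f.
have d0 : ratf_den f != 0.
  apply: contraTneq cop => d0; rewrite d0 coprimep0.
  move/eqP: E; rewrite d0 mul0r mulf_eq0 (negPf D0) orbF => /eqP ->.
  by rewrite eqp_sym eqp0 oner_eq0.
have n0 : ratf_num f != 0.
  by apply: contra_eq_neq E => ->; rewrite mul0r eq_sym mulf_neq0.
rewrite mup_mu //.
have := congr1 (multiplicity x) E; rewrite !mu_mul ?mulf_neq0 //.
case: (boolP (root (ratf_num f) x)) => rx.
  have /muNroot -> : ~~ root (ratf_den f) x.
    by have := coprimep_root cop rx.
  by rewrite add0n => <-; rewrite addnK.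
by rewrite (muNroot rx) add0n => ->; lia.
Qed.

(** * The numerator of the derivative of a logarithmic derivative *)

(** The numerator of [(f'/f)'] over the denominator [f ^+ 2], before any
    cancellation. *)
Definition logder_num (R : comNzRingType) (f : {poly R}) : {poly R} :=
  f * f^`(2) - f^`() ^+ 2.

Lemma logder_numM (R : comNzRingType) (f g : {poly R}) :
  logder_num (f * g) = logder_num f * g ^+ 2 + f ^+ 2 * logder_num g.
Proof.
have d2 (q : {poly R}) : q^`(2) = q^`()^`() by [].
by rewrite /logder_num !d2 !(derivM, derivD); ring.
Qed.

Lemma logder_num_XsubC (R : comNzRingType) (x : R) (n : nat) :
  logder_num (('X - x%:P) ^+ n.+1) = - (n.+1%:R *: ('X - x%:P) ^+ (2 * n)).
Proof.
have H1 : logder_num ('X - x%:P) = -1.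
  rewrite /logder_num [_^`(2)]derivSn derivn1 derivXsubC derivC.
  by rewrite mulr0 expr1n sub0r.
elim: n => [|n IH]; first by rewrite expr1 muln0 expr0 scale1r.
rewrite [in LHS]exprS logder_numM IH H1 -[n.+2]addn1 natrD scalerDl.
rewrite scale1r opprD mulN1r addrC -exprM; congr (_ - _); last by congr (_ ^+ _); lia.
by rewrite mulrN -scalerAr -exprD; congr (- (_ *: _ ^+ _)); lia.
Qed.

(** A root of multiplicity [a > 0] of [p] is a root of multiplicity exactly
    [2 a - 2] of [logder_num p], and the cofactor is negative there: it takes
    the value [- a g(x)^2] if [p = g ('X - x) ^+ a]. *)
Lemma logder_num_near_root (R : realDomainType) (p : {poly R}) (x : R) :
  p != 0 -> root p x ->
  exists h : {poly R}, h.[x] < 0 /\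
    logder_num p = h * ('X - x%:P) ^+ (2 * (\mu_x p).-1).
Proof.
move=> p0 rx; have [g gx E] := mu_spec x p0.
have : (0 < \mu_x p)%N by rewrite mu_gt0.
case: (\mu_x p) E => // n E _ /=.
exists (- (n.+1%:R *: g ^+ 2) + ('X - x%:P) ^+ 2 * logder_num g); split.
  have g2 : 0 < g.[x] ^+ 2 by rewrite lt0r sqr_ge0 expf_neq0.
  rewrite hornerD hornerN hornerZ horner_exp [X in _ + X]hornerM horner_exp.
  by rewrite hornerXsubC subrr expr0n mul0r addr0 oppr_lt0 mulr_gt0 ?ltr0n.
rewrite E mulrC logder_numM logder_num_XsubC mulrDl; congr (_ + _).
  by rewrite !mulNr -!scalerAl mulrC.
by rewrite [RHS]mulrAC -exprD -exprM; congr (_ ^+ _ * _); lia.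
Qed.

Lemma predn_size_mul (R : idomainType) (f g : {poly R}) : f != 0 -> g != 0 ->
  (size (f * g)).-1 = ((size f).-1 + (size g).-1)%N.
Proof.
by move=> f0 g0; rewrite size_mul // (polySpred f0) (polySpred g0) addSn addnS.
Qed.

Lemma coef_mul_top (R : nzRingType) (p q : {poly R}) (m n : nat) :
  (size p <= m.+1)%N -> (size q <= n.+1)%N -> (p * q)`_(m + n) = p`_m * q`_n.
Proof.
move=> sp sq; rewrite coefM.
have lm : (m < (m + n).+1)%N by lia.
rewrite (bigD1 (Ordinal lm)) //= addKn big1 ?addr0 // => -[i /= li] /eqP ne.
have {}ne : i <> m by move=> e; apply: ne; apply: val_inj.
have [im|im] := ltnP i m.
  have -> : q`_(m + n - i) = 0.
    by apply: nth_default; apply: leq_trans sq _; lia.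
  by rewrite mulr0.
have -> : p`_i = 0 by apply: nth_default; apply: leq_trans sp _; lia.
by rewrite mul0r.
Qed.

(** If [p] has degree [n > 0] and leading coefficient [c], then [logder_num p]
    has leading term [(n (n - 1) - n^2) c^2 X^(2 n - 2) = - n c^2 X^(2 n - 2)]. *)
Lemma logder_num_lead (R : realDomainType) (p : {poly R}) : (1 < size p)%N ->
  size (logder_num p) = (2 * (size p).-1).-1 /\
  lead_coef (logder_num p) = - ((size p).-1%:R * lead_coef p ^+ 2).
Proof.
set n := (size p).-1 => sp.
have szp : size p = n.+1 by rewrite /n prednK // ltnW.
have n0 : (0 < n)%N by lia.
have lc0 : lead_coef p != 0 by rewrite lead_coef_eq0 -size_poly_gt0; lia.
(* Multiplying by 'X^2 makes every factor of degree at most n, which avoids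
   the truncated exponent n - 2 when n = 1. *)
pose M := logder_num p * 'X^2.
have EM : M = p * ('X^2 * p^`(2)) - ('X * p^`()) ^+ 2 by rewrite /M /logder_num; ring.
have s1 : (size ('X * p^`())%R <= n.+1)%N.
  apply: leq_trans (size_polyMleq _ _) _; rewrite size_polyX size_deriv; lia.
have s2 : (size ('X^2 * p^`(2))%R <= n.+1)%N.
  have [n2|n2] := leqP 2 n.
    apply: leq_trans (size_polyMleq _ _) _.
    by rewrite size_polyXn [_^`(2)]derivSn derivn1 !size_deriv; lia.
  have -> : p^`(2) = 0 by apply/eqP; rewrite -derivn_poly0; lia.
  by rewrite mulr0 size_poly0.
have sM : (size M <= (2 * n).+1)%N.
  rewrite EM; apply: leq_trans (size_polyD _ _) _.
  rewrite size_polyN geq_max [('X * _) ^+ 2]expr2.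
  apply/andP; split; apply: leq_trans (size_polyMleq _ _) _;
    rewrite -subn1 leq_subLR.
    by apply: leq_trans (leq_add (eq_leq szp) s2) _; lia.
  by apply: leq_trans (leq_add s1 s1) _; lia.
have cM : M`_(2 * n) = - (n%:R * lead_coef p ^+ 2).
  rewrite mulSn mul1n EM coefB [('X * _) ^+ 2]expr2 !coef_mul_top ?szp //.
  rewrite coefXnM coefXM coef_derivn coef_deriv lead_coefE -/n /=.
  case: (n) n0 => [//|[|k]] _ /=; first by rewrite mulr0 sub0r mulr1n mul1r expr2.
  rewrite subSS subSS subn0 add2n ffactnSr ffactn1 subn1 /=.
  have E2 : k.+2%:R = k.+1%:R + 1 :> R by rewrite -natr1.
  rewrite -[_ *+ (_ * _)]mulr_natr -[_ *+ k.+2]mulr_natr natrM E2.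
  by move: (k.+1%:R : R) => a; move: (p`_k.+2) => c; ring.
have cM0 : M`_(2 * n) != 0.
  by rewrite cM oppr_eq0 mulf_neq0 ?expf_neq0 // pnatr_eq0; lia.
have szM : size M = (2 * n).+1.
  apply/eqP; rewrite eqn_leq sM ltnNge; apply/negP => le.
  by rewrite nth_default ?eqxx in cM0.
have N0 : logder_num p != 0.
  by apply: contraNneq cM0; rewrite /M => ->; rewrite mul0r coef0.
split.
  move: szM; rewrite /M size_mulXn // => ?; lia.
rewrite -cM -[(2 * n)%N]/((2 * n).+1.-1) -szM -lead_coefE.
by rewrite /M lead_coef_Mmonic ?monicXn.
Qed.

(** * The polynomial p' + sigma p *)

(** As [sigma] varies, these are up to the factor [p] the translates
    [p'/p + sigma] of the logarithmic derivative of [p]. *)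
Definition pencil (R : nzRingType) (sigma : R) (p : {poly R}) : {poly R} :=
  p^`() + sigma *: p.

Lemma horner_logder_num (R : comNzRingType) (f : {poly R}) (x : R) :
  (logder_num f).[x] = f.[x] * f^`()^`().[x] - f^`().[x] ^+ 2.
Proof.
have d2 : f^`(2) = f^`()^`() by [].
by rewrite /logder_num d2 hornerD hornerN hornerM horner_exp.
Qed.

(** This is the identity [(p'/p)' = (q/p)'] for [q = p' + sigma p], cleared of
    denominators. *)
Lemma logder_num_pencil (R : comNzRingType) (sigma : R) (p : {poly R}) :
  logder_num p = p * (pencil sigma p)^`() - pencil sigma p * p^`().
Proof.
have d2 (q : {poly R}) : q^`(2) = q^`()^`() by [].
by rewrite /logder_num /pencil !d2 derivD derivZ -!mul_polyC; ring.
Qed.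

Lemma lead_coef_deriv (R : realDomainType) (p : {poly R}) :
  (1 < size p)%N -> lead_coef p^`() = lead_coef p *+ (size p).-1.
Proof.
by rewrite !lead_coefE size_deriv coef_deriv; case: (size p) => [|[|n]].
Qed.

Lemma size_lead_pencil (R : realDomainType) (sigma : R) (p : {poly R}) :
  (1 < size p)%N ->
  size (pencil sigma p) = (size p - (sigma == 0%R))%N /\
  lead_coef (pencil sigma p) =
    (if sigma == 0 then (size p).-1%:R else sigma) * lead_coef p.
Proof.
move=> sp; rewrite /pencil; have [->|s0] := eqVneq sigma 0.
  by rewrite scale0r addr0 size_deriv subn1 lead_coef_deriv // mulr_natl.
have lt : (size p^`() < size (sigma *: p))%N.
  by rewrite size_deriv size_scale // ltn_predL ltnW.
by rewrite addrC size_polyDl // lead_coefDl // size_scale // lead_coefZ subn0.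
Qed.

(** * Local behaviour at the real points *)

Section LocalAnalysis.
Variables (R : rcfType) (sigma : R) (p : {poly R}).
Hypothesis sp : (1 < size p)%N.

Let q : {poly R} := pencil sigma p.
Let N : {poly R} := logder_num p.

(* The instance of mu_deriv at R, with the integral domain structure that is
   inferred from the real closed field R. *)
Let mu_deriv_pred (f : {poly R}) x : root f x -> \mu_x f^`() = (\mu_x f).-1.
Proof. by move=> rx; rewrite -subn1; exact: mu_deriv. Qed.

Let p0 : p != 0. Proof. by rewrite -size_poly_gt0; lia. Qed.

Lemma pencil_neq0 : q != 0.
Proof.
rewrite -size_poly_gt0 /q (size_lead_pencil _ _).1 //.
by case: eqP => _; rewrite ?subn0 ?subn_gt0 // ltnW.
Qed.
Let q0 := pencil_neq0.

Lemma logder_num_neq0 : N != 0.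
Proof.
rewrite -lead_coef_eq0 (logder_num_lead sp).2 oppr_eq0 mulf_neq0 //.
  by rewrite pnatr_eq0 -lt0n -subn1 subn_gt0.
by rewrite expf_neq0 // lead_coef_eq0.
Qed.
Let N0 := logder_num_neq0.

Lemma pencil_near_root x : root p x ->
  \mu_x q = (\mu_x p).-1 /\ sgp_right q x = sgp_right p x.
Proof.
move=> rx; have mp : (0 < \mu_x p)%N by rewrite mu_gt0.
have d0 : p^`() != 0.
  by rewrite -size_poly_gt0 size_deriv -subn1 subn_gt0.
rewrite (sgp_right_deriv rx) /q /pencil -(mu_deriv_pred rx).
have [->|s0] := eqVneq sigma 0; first by rewrite scale0r addr0.
have lt : (\mu_x p^`() < \mu_x (sigma *: p))%N.
  by rewrite mu_mulC // mu_deriv_pred // ltn_predL.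
by split; [rewrite mu_addr | rewrite addrC sgp_right_addp0].
Qed.

(** At a root of [p], [N / (p * q)] has a simple pole with negative residue. *)
Lemma multiplicities_at_root x : root p x ->
  [/\ \mu_x N = (2 * (\mu_x p).-1)%N, \mu_x q = (\mu_x p).-1,
      jump N (p * q) x = -1 & jump (p * q) N x = 0].
Proof.
move=> rx; have mp : (0 < \mu_x p)%N by rewrite mu_gt0.
have [mq sq] := pencil_near_root rx.
have [h [hx EN]] := logder_num_near_root p0 rx.
have h0 : ~~ root h x by rewrite /root lt_eqF.
have mN : \mu_x N = (2 * (\mu_x p).-1)%N by rewrite /N EN cofactor_XsubC_mu.
have sN : sgp_right N x = -1.
  rewrite /N EN sgp_right_mul (sgp_rightNroot h0) ltr0_sg //.
  rewrite mulSn mul1n exprD sgp_right_mul sgp_right_square ?mulr1 //.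
  by rewrite expf_neq0 // polyXsubC_eq0.
split=> //.
  rewrite /jump mu_mul ?mulf_neq0 // mN mq N0 !sgp_right_mul sN sq.
  rewrite sgp_right_square // mulr1 oppr_lt0 ltr01 /=.
  by have -> : (\mu_x p + (\mu_x p).-1 - 2 * (\mu_x p).-1 = 1)%N by lia.
rewrite /jump mu_mul ?mulf_neq0 // mN mq.
by have -> : (2 * (\mu_x p).-1 - (\mu_x p + (\mu_x p).-1) = 0)%N by lia.
Qed.

(** At a root of [q] where [p] does not vanish, [N / (p * q)] has a simple pole
    with positive residue. *)
Lemma multiplicities_at_pencil_root x : ~~ root p x -> root q x ->
  [/\ \mu_x N = (\mu_x q).-1, jump N (p * q) x = 1 & jump (p * q) N x = 0].
Proof.
move=> rp rq; have mq : (0 < \mu_x q)%N by rewrite mu_gt0.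
have EN : N = p * q^`() - q * p^`() := logder_num_pencil sigma p.
have mp : \mu_x p = 0%N by rewrite muNroot.
have d0 : q^`() != 0.
  apply: contraTneq rq => d0; move: q0.
  have : (size q <= 1)%N.
    by rewrite -[size q]prednK ?size_poly_gt0 // -size_deriv d0 size_poly0.
  by move/size1_polyC ->; rewrite polyC_eq0 rootC.
have m1 : \mu_x (p * q^`()) = (\mu_x q).-1.
  by rewrite mu_mul ?mulf_neq0 // mp mu_deriv_pred.
have [mN sN] : \mu_x N = (\mu_x q).-1 /\ sgp_right N x = sgp_right p x * sgp_right q x.
  rewrite EN (sgp_right_deriv rq) -sgp_right_mul.
  have [e|e0] := eqVneq (q * p^`()) 0; first by rewrite e subr0.
  have lt : (\mu_x (p * q^`()) < \mu_x (- (q * p^`())))%N.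
    by rewrite m1 mu_opp mu_mul //; lia.
  by rewrite mu_addr ?mulf_neq0 // m1 addrC sgp_right_addp0 ?mulf_neq0.
split=> //.
  rewrite /jump mu_mul ?mulf_neq0 // mN mp N0 !sgp_right_mul sN -sgp_right_mul.
  rewrite sgp_right_square ?mulf_neq0 // ltr10.
  by have -> : (0 + \mu_x q - (\mu_x q).-1 = 1)%N by lia.
rewrite /jump mu_mul ?mulf_neq0 // mN mp.
by have -> : ((\mu_x q).-1 - (0 + \mu_x q) = 0)%N by lia.
Qed.

(** Away from the roots of [p * q], a root of [N] at which [Q[q]] is negative is
    simple, and [N / (p * q)] changes sign there from [+] to [-]. *)
Lemma multiplicities_at_critical_point x : ~~ root p x -> ~~ root q x -> root N x ->
  (logder_num q).[x] < 0 ->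
  [/\ \mu_x N = 1%N, jump N (p * q) x = 0 & jump (p * q) N x = -1].
Proof.
move=> rp rq rN Q_lt0.
have EN : N = p * q^`() - q * p^`() := logder_num_pencil sigma p.
have E1 : N^`().[x] = p.[x] * q^`()^`().[x] - q.[x] * p^`()^`().[x].
  by rewrite EN !(derivB, derivM) !hornerE; ring.
have E2 : p.[x] * p^`()^`().[x] = p^`().[x] ^+ 2.
  by move/eqP: rN; rewrite horner_logder_num => /subr0_eq.
have E3 : p.[x] * q^`().[x] = q.[x] * p^`().[x].
  by move/eqP: rN; rewrite EN hornerD hornerN !hornerM => /subr0_eq.
(* From N(x) = 0, p p'' = p'^2 and p q' = q p' at x, so that
   p q N' = p^2 q q'' - (q p')^2 = p^2 (q q'' - q'^2) there. *)
have lt : p.[x] * q.[x] * N^`().[x] < 0.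
  have -> : p.[x] * q.[x] * N^`().[x] = p.[x] ^+ 2 * (logder_num q).[x].
    rewrite E1 horner_logder_num.
    have -> : p.[x] * q.[x] * (p.[x] * q^`()^`().[x] - q.[x] * p^`()^`().[x]) =
      p.[x] ^+ 2 * (q.[x] * q^`()^`().[x]) - q.[x] ^+ 2 * (p.[x] * p^`()^`().[x]).
      ring.
    by rewrite E2 mulrBr -!exprMn E3.
  by rewrite pmulr_rlt0 // lt0r sqr_ge0 expf_neq0.
have rN' : ~~ root N^`() x.
  by apply/negP => /eqP e; rewrite e mulr0 ltxx in lt.
have mN : \mu_x N = 1%N by rewrite mu_deriv_root // (muNroot rN').
have rpq : ~~ root (p * q) x by rewrite rootM negb_or rp.
split=> //; first by rewrite noroot_jump.
rewrite /jump mN (muNroot rpq) mulf_neq0 // sgp_right_mul (sgp_rightNroot rpq).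
by rewrite (sgp_right_deriv rN) (sgp_rightNroot rN') -sgrM hornerM sgr_lt0 lt.
Qed.

(** The variation between the two infinities of the sign of [N / (p * q)], a
    rational function that behaves like [- 1 / z] if [sigma = 0] and has even
    order at infinity otherwise. *)
Lemma crossR_logder_num :
  crossR (p * q * N) = - (sigma == 0)%:Z.
Proof.
have [sq lq] := size_lead_pencil sigma sp.
have [sN lN] := logder_num_lead sp.
have lp0 : lead_coef p != 0 by rewrite lead_coef_eq0.
set A := p * q * N.
have sA : (size A).-1 = ((size p).-1 + (size q).-1 + (size N).-1)%N.
  by rewrite /A !predn_size_mul ?mulf_neq0.
have lA : lead_coef A = lead_coef p * lead_coef q * lead_coef N by rewrite !lead_coefM.
rewrite /crossR /sgp_pinfty /sgp_minfty.
have oA : odd (size A).-1 = (sigma == 0).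
  have parity (k : nat) (b : bool) : (1 < k)%N ->
      odd (k.-1 + (k - b).-1 + (2 * k.-1).-1.-1) = b by case: b; lia.
  by rewrite sA sN /q sq parity.
rewrite -signr_odd oA.
have [s0|s0] := eqVneq sigma 0; last first.
  by rewrite expr0 mul1r /variation -sgrM sgr_lt0 ltNge sqr_ge0 mulr0.
have lA0 : lead_coef A < 0.
  rewrite lA lN /q lq s0 eqxx.
  have a0 : 0 < (size p).-1%:R :> R by rewrite ltr0n; lia.
  have -> : lead_coef p * ((size p).-1%:R * lead_coef p) *
     - ((size p).-1%:R * lead_coef p ^+ 2) = - ((size p).-1%:R * lead_coef p ^+ 2) ^+ 2.
    move: (lead_coef p) ((size p).-1%:R : R) => c a; ring.
  rewrite oppr_lt0 lt0r sqr_ge0 andbT expf_neq0 // mulf_neq0 ?expf_neq0 //.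
  by rewrite gt_eqF.
by rewrite expr1 mulN1r sgrN ltr0_sg // /variation opprK mul1r ltrN10 sgzN sgz1.
Qed.

End LocalAnalysis.

(** * Counting the real zeros of Q *)

Lemma Q_logder_num (K : fieldType) (f : {poly K}) :
  Q f = tofrac (logder_num f) / tofrac (f ^+ 2).
Proof. by []. Qed.

Lemma mup_Q (R : rcfType) (p : {poly R}) (x : R) : (1 < size p)%N ->
  mup x (ratf_num (Q p)) = (\mu_x (logder_num p) - 2 * \mu_x p)%N.
Proof.
move=> sp; have p0 : p != 0 by rewrite -size_poly_gt0 ltnW.
by rewrite Q_logder_num mup_ratf_num ?logder_num_neq0 ?expf_neq0 // mu_exp mulnC.
Qed.

Lemma Q_lt0 (R : realFieldType) (f : {poly R}) (x : R) :
  (forall y, ratf_defined_at (Q f) y -> ratf_eval (Q f) y < 0) ->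
  ~~ root f x -> (logder_num f).[x] < 0.
Proof.
move=> neg rf; have f2 : (f ^+ 2).[x] != 0 by rewrite horner_exp expf_neq0.
have := neg x; rewrite Q_logder_num ratf_evalE // => /(_ (ratf_defined _ f2)).
by rewrite pmulr_llt0 // invr_gt0 lt0r f2 horner_exp sqr_ge0.
Qed.

Theorem theorem4p5 (R : realType) (p : {poly R}) (m : nat) (sigma : R)
    (p_sigma := p^`() + sigma *: p) :
  (1 < size p)%N ->
  ZC p = (2 * m)%N ->
  (forall x : R, ratf_defined_at (Q p_sigma) x -> ratf_eval (Q p_sigma) x < 0) ->
  exists m_sigma : nat,
    [/\ ZC p_sigma = (2 * m_sigma)%N,
        (ratf_ZR (Q p))%:Z = (2 * m)%:Z - (2 * m_sigma)%:Z
      & forall x : R,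
          root (ratf_num (Q p)) x -> ~ (2 < mup x p_sigma)%N ->
          mup x (ratf_num (Q p)) = 1%N].
Proof.
move=> sp ZCp neg.
have p0 : p != 0 by rewrite -size_poly_gt0 ltnW.
pose q : {poly R} := p_sigma; pose N : {poly R} := logder_num p.
have q0 : q != 0 := pencil_neq0 sigma sp.
have N0 : N != 0 := logder_num_neq0 sp.
have pq0 : p * q != 0 by rewrite mulf_neq0.
have n0 : ratf_num (Q p) != 0.
  apply/negP => /eqP n0; have D0 : p ^+ 2 != 0 by rewrite expf_neq0.
  have := ratf_cross N D0; rewrite -[_ / _]/(Q p) n0 mul0r => /esym/eqP.
  rewrite mulf_eq0 (negPf N0) orbF => /eqP d0.
  by have := ratf_coprime (Q p); rewrite n0 d0 coprimep0 eqp_sym eqp0 oner_eq0.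
have muQ x : \mu_x (ratf_num (Q p)) = (\mu_x N - 2 * \mu_x p)%N.
  by rewrite -mup_mu // mup_Q.
have [k ZCq] := ZC_even q0; exists k.
(* Pointwise form of the count. The two jumps are the local contributions to
   the indices of N / (p q) and of its inverse. *)
have local x :
    (\mu_x (ratf_num (Q p)))%:Z + (\mu_x p)%:Z + jump N (p * q) x =
    (\mu_x q)%:Z - jump (p * q) N x.
  rewrite muQ; case: (boolP (root p x)) => rp.
    have [-> -> -> ->] := multiplicities_at_root sigma sp rp.
    have : (0 < \mu_x p)%N by rewrite mu_gt0.
    by case: (\mu_x p) => // a _; lia.
  rewrite (muNroot rp); case: (boolP (root q x)) => rq.
    have [-> -> ->] := multiplicities_at_pencil_root sp rp rq.
    have : (0 < \mu_x q)%N by rewrite mu_gt0.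
    by case: (\mu_x q) => // a _; lia.
  rewrite (muNroot rq); case: (boolP (root N x)) => rN.
    have [-> -> -> //] :=
      multiplicities_at_critical_point sp rp rq rN (Q_lt0 neg rq).
  by rewrite (muNroot rN) !noroot_jump // rootM negb_or rp.
split=> //.
  (* One set of points supports all the sums. *)
  pose s := rootsR (p * q * N).
  have us : uniq s by apply: uniq_roots.
  have ms x : root (p * q * N) x -> x \in s.
    by move=> rx; rewrite -roots_on_rootsR ?mulf_neq0.
  have msp x : root p x -> x \in s by move=> rx; rewrite ms // !rootM rx.
  have msq x : root q x -> x \in s by move=> rx; rewrite ms // !rootM rx orbT.
  have mspq x : root (p * q) x -> x \in s by move=> rx; rewrite ms // rootM rx.
  have msN x : root N x -> x \in s by move=> rx; rewrite ms // !rootM rx orbT.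
  have msQ x : root (ratf_num (Q p)) x -> x \in s.
    rewrite -mu_gt0 // muQ => rx; apply: msN; rewrite -mu_gt0 //.
    exact: leq_trans rx (leq_subr _ _).
  have total : (ZR (ratf_num (Q p)))%:Z + (ZR p)%:Z + cindexR N (p * q) =
               (ZR q)%:Z - cindexR (p * q) N.
    rewrite (ZR_sum_mu n0 us msQ) (ZR_sum_mu p0 us msp) (ZR_sum_mu q0 us msq).
    rewrite (cindexR_sum N pq0 us mspq) (cindexR_sum (p * q) N0 us msN).
    rewrite !(big_morph Posz PoszD (erefl 0%:Z)) -!big_split -sumrB /=.
    by apply: eq_bigr => x _; apply: local.
  have inv := cindexR_inv pq0 N0; rewrite crossR_logder_num // in inv.
  have zp := ZR_ZC p0; have zq := ZR_ZC q0.
  rewrite [size q](size_lead_pencil sigma sp).1 in zq.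
  rewrite /ratf_ZR; move: zp zq inv total sp; rewrite ZCp ZCq.
  move: (size p) => n; case: (sigma == 0); lia.
move=> x rx mq; have := rx; rewrite -mu_gt0 // muQ mup_mu // muQ => gt0.
case: (boolP (root p x)) => rp.
  have [E _ _ _] := multiplicities_at_root sigma sp rp; move: gt0; rewrite E.
  by case: (\mu_x p) => // a; lia.
move: gt0; rewrite (muNroot rp) muln0 subn0 => gt0.
have rN : root N x by rewrite -mu_gt0.
case: (boolP (root q x)) => rq; last first.
  by have [] := multiplicities_at_critical_point sp rp rq rN (Q_lt0 neg rq).
have [E _ _] := multiplicities_at_pencil_root sp rp rq; move: gt0; rewrite E.
by move: mq; rewrite (mup_mu x q0); case: (\mu_x q) => [|[|[|a]]].
Qed.
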